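(* Let $e\ge1$, $r\ge3$, $B=B(2e,e,r)$, and let $\mathbb{Z}_\epsilon$ be $\mathbb{Z}$ with $B$ acting through the sign morphism $\epsilon:B\to\{\pm1\}$ defined in the context. Write $\mathbb{Z}_n=\mathbb{Z}/n\mathbb{Z}$. Then: \begin{itemize} \item $H_1(B,\mathbb{Z}_\epsilon)\simeq\mathbb{Z}_2$ for $r\ge5$; \item $H_1(B,\mathbb{Z}_\epsilon)\simeq\mathbb{Z}_6$ for $r=4$, $e\equiv0,2\bmod4$; \item $H_1(B,\mathbb{Z}_\epsilon)\simeq\mathbb{Z}_2$ for $r=4$, $e\equiv1\bmod4$; \item $H_1(B,\mathbb{Z}_\epsilon)\simeq\mathbb{Z}_3\oplus\mathbb{Z}_3\oplus\mathbb{Z}_2$ for $r=3$, $e\equiv0\bmod3$; \item $H_1(B,\mathbb{Z}_\epsilon)\simeq\mathbb{Z}_6$ for $r=3$, $e\equiv1\bmod3$. \end{itemize}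
   Context: $B(2e,e,r)$ (also written $B( *e,e,r)$, since $B(de,e,r)\simeq B(2e,e,r)$ for all $d>1$) is the braid group of the complex reflection group $G(2e,e,r)$; it is isomorphic to the semidirect product $\mathbb{Z}_{\tau^e}\ltimes\mathrm{A}$, where $\mathbb{Z}_{\tau^e}$ is the infinite cyclic group generated by a symbol $\tau^e$, and $\mathrm{A}$ is the Artin group of affine type $\widetilde{A}_{r-1}$: generators $\sigma_i$ ($i\in\mathbb{Z}/r$), relations $\sigma_i\sigma_{i+1}\sigma_i=\sigma_{i+1}\sigma_i\sigma_{i+1}$ and $\sigma_i\sigma_j=\sigma_j\sigma_i$ for $j\ne i,i\pm1$; the action is $\tau^e\sigma_i\tau^{-e}=\sigma_{i+e}$ (indices modulo $r$). The morphism $\epsilon:B\to\{\pm1\}$ is given by $\epsilon(\sigma_i)=-1$ for all $i$ and $\epsilon(\tau^e)=1$. *)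

(* Defs.v *)
From HB Require Import structures.
From mathcomp Require Import all_boot all_order all_algebra.
From mathcomp Require Import ring_quotient finmap boolp.
From mathcomp Require Import monalg.

Set Implicit Arguments.
Unset Strict Implicit.
Unset Printing Implicit Defensive.

Import GRing.Theory.
Local Open Scope ring_scope.
Local Open Scope quotient_scope.

(** * Groups given by generators and relations *)

(* A letter [(x, false)] is the generator [x], and [(x, true)] its inverse. *)
Notation word X := (seq (X * bool)).

Definition letter (X : Type) (x : X) : X * bool := (x, false).

Section Presented.
Variables (X : choiceType) (R : word X -> word X -> Prop).

Inductive pres_eqv : word X -> word X -> Prop :=
| PresRefl u : pres_eqv u u
| PresSym u v : pres_eqv u v -> pres_eqv v u
| PresTrans u v w : pres_eqv u v -> pres_eqv v w -> pres_eqv u w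
| PresCat u u' v v' : pres_eqv u u' -> pres_eqv v v' ->
    pres_eqv (u ++ v) (u' ++ v')
| PresCancel x b : pres_eqv [:: (x, b); (x, ~~ b)] [::]
| PresRel u v : R u v -> pres_eqv u v.

Definition pres_eqb (u v : word X) : bool := `[< pres_eqv u v >].

Lemma pres_eqb_equiv : equiv_class_of pres_eqb.
Proof.
split=> [u|u v|v u w].
- by apply/asboolP; apply: PresRefl.
- by apply/asboolP/asboolP; apply: PresSym.
- by move=> /asboolP uv /asboolP vw; apply/asboolP; apply: PresTrans uv vw.
Qed.

Canonical pres_eqb_equiv_rel := EquivRelPack pres_eqb_equiv.

Definition presented : Type := {eq_quot pres_eqb}.

HB.instance Definition _ := Choice.on presented.
HB.instance Definition _ : EqQuotient (word X) pres_eqb presented :=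
  EqQuotient.on presented.

Definition pres_word (u : word X) : presented := \pi_presented u.

Lemma pres_wordP u v : pres_word u = pres_word v <-> pres_eqv u v.
Proof.
by split=> [/eqmodP/asboolP|uv]; last by apply/eqmodP/asboolP.
Qed.

Lemma pres_reprK (x : presented) : pres_word (repr x) = x.
Proof. exact: reprK. Qed.

Lemma pres_reprP u : pres_eqv (repr (pres_word u)) u.
Proof. by apply/pres_wordP; rewrite pres_reprK. Qed.

Definition winv (u : word X) : word X := [seq (a.1, ~~ a.2) | a <- rev u].

Lemma winv_cons a u : winv (a :: u) = winv u ++ [:: (a.1, ~~ a.2)].
Proof. by rewrite /winv rev_cons map_rcons cats1. Qed.

Lemma winvV u : pres_eqv (u ++ winv u) [::].
Proof.
elim: u => [|[x b] u IH]; first exact: PresRefl.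
have -> : ((x, b) :: u) ++ winv ((x, b) :: u) =
          ([:: (x, b)] ++ (u ++ winv u)) ++ [:: (x, ~~ b)].
  by rewrite winv_cons /= catA.
apply: PresTrans _ (PresCancel x b).
rewrite -[X in pres_eqv _ X]/(([:: (x, b)] ++ [::]) ++ [:: (x, ~~ b)]).
by apply: PresCat _ (PresRefl _); apply: PresCat (PresRefl _) IH.
Qed.

Lemma winvK u : winv (winv u) = u.
Proof.
rewrite /winv -map_rev revK -map_comp -[RHS]map_id.
by apply: eq_map => -[x b] /=; rewrite negbK.
Qed.

Lemma winv_eqv u v : pres_eqv u v -> pres_eqv (winv u) (winv v).
Proof.
move=> uv.
have h1 : pres_eqv (winv u) (winv u ++ (v ++ winv v)).
  rewrite -[X in pres_eqv X _]cats0; apply: PresCat (PresRefl _) _.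
  exact/PresSym/winvV.
apply: PresTrans h1 _; rewrite catA -[X in pres_eqv _ X]cat0s.
apply: PresCat _ (PresRefl _).
apply: PresTrans (PresCat (PresRefl _) (PresSym uv)) _.
by rewrite -[X in _ ++ X]winvK; apply: winvV.
Qed.

Definition pres_mul (x y : presented) := pres_word (repr x ++ repr y).
Definition pres_inv (x : presented) := pres_word (winv (repr x)).

Lemma pres_mulE u v : pres_mul (pres_word u) (pres_word v) = pres_word (u ++ v).
Proof. by apply/pres_wordP; apply: PresCat; apply: pres_reprP. Qed.

Lemma pres_invE u : pres_inv (pres_word u) = pres_word (winv u).
Proof. by apply/pres_wordP; apply: winv_eqv; apply: pres_reprP. Qed.

Lemma pres_mulA : associative pres_mul.
Proof.
by move=> x y z; rewrite -(pres_reprK x) -(pres_reprK y) -(pres_reprK z)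
  !pres_mulE catA.
Qed.

Lemma pres_mul1 : left_id (pres_word [::]) pres_mul.
Proof. by move=> x; rewrite -(pres_reprK x) pres_mulE. Qed.

Lemma pres_1mul : right_id (pres_word [::]) pres_mul.
Proof. by move=> x; rewrite -(pres_reprK x) pres_mulE cats0. Qed.

Lemma pres_mulV : left_inverse (pres_word [::]) pres_inv pres_mul.
Proof.
move=> x; rewrite -(pres_reprK x) pres_invE pres_mulE; apply/pres_wordP.
by rewrite -[X in _ ++ X]winvK; apply: winvV.
Qed.

Lemma pres_Vmul : right_inverse (pres_word [::]) pres_inv pres_mul.
Proof.
move=> x; rewrite -(pres_reprK x) pres_invE pres_mulE; apply/pres_wordP.
exact: winvV.
Qed.

HB.instance Definition _ := isGroup.Build presented
  pres_mulA pres_mul1 pres_1mul pres_mulV pres_Vmul.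

Definition pres_gen (x : X) : presented := pres_word [:: letter x].

Lemma pres_wordM u v : pres_word (u ++ v) = (pres_word u * pres_word v)%g.
Proof. by rewrite -pres_mulE. Qed.

Lemma pres_wordV u : pres_word (winv u) = ((pres_word u)^-1)%g.
Proof. by rewrite -pres_invE. Qed.

Section Lift.
Variables (H : groupType) (f : X -> H).

Definition word_eval (u : word X) : H :=
  (\prod_(a <- u) (if a.2 then (f a.1)^-1 else f a.1))%g.

Hypothesis fR : forall u v, R u v -> word_eval u = word_eval v.

Definition pres_lift (x : presented) : H := word_eval (repr x).

Lemma pres_eqv_eval u v : pres_eqv u v -> word_eval u = word_eval v.
Proof.
elim=> {u v} // [u v w _ -> _ -> // | u u' v v' _ E _ E' | x b].
- by rewrite /word_eval !big_cat /=; congr (_ * _)%g.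
- by rewrite /word_eval !big_cons big_nil mulg1; case: b => /=;
    rewrite ?mulVg ?mulgV.
Qed.

Lemma pres_lift_word u : pres_lift (pres_word u) = word_eval u.
Proof. exact/pres_eqv_eval/pres_reprP. Qed.

Lemma pres_liftM x y : pres_lift (x * y)%g = (pres_lift x * pres_lift y)%g.
Proof.
rewrite -(pres_reprK x) -(pres_reprK y) -pres_wordM !pres_lift_word.
by rewrite /word_eval big_cat.
Qed.

Lemma pres_lift_gen x : pres_lift (pres_gen x) = f x.
Proof. by rewrite pres_lift_word /word_eval big_seq1. Qed.

End Lift.

Lemma pres_ind (P : presented -> Prop) :
  P 1%g -> (forall x y, P y -> P (pres_gen x * y)%g) ->
  (forall x y, P y -> P ((pres_gen x)^-1 * y)%g) -> forall x, P x.
Proof.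
move=> P1 Pg PV x; rewrite -(pres_reprK x).
elim: (repr x) => [|[y b] u IH]; first exact: P1.
rewrite -cat1s pres_wordM; case: b; last exact: Pg.
suff -> : pres_word [:: (y, true)] = ((pres_gen y)^-1)%g by exact: PV.
by rewrite -pres_wordV.
Qed.

Lemma word_eval_gen (h : X -> X) (u : word X) :
  word_eval (fun x => pres_gen (h x)) u = pres_word [seq (h a.1, a.2) | a <- u].
Proof.
elim: u => [|[x b] u IH]; first by rewrite /word_eval big_nil.
rewrite /word_eval big_cons [X in (_ * X)%g]IH /= -[RHS]/(pres_word ([:: (h x, b)] ++ _)).
rewrite pres_wordM; congr (_ * _)%g.
by case: b => //=; rewrite -pres_wordV.
Qed.

End Presented.

(** * Semidirect products *)

Record group_action (K N : groupType) := GroupAction {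
  gact_fun :> K -> N -> N;
  gact_fun1 : forall n, gact_fun 1%g n = n;
  gact_funM : forall k l n, gact_fun (k * l)%g n = gact_fun k (gact_fun l n);
  gact_fun_mul : forall k m n,
    gact_fun k (m * n)%g = (gact_fun k m * gact_fun k n)%g
}.

(* The pair [(k, n)] stands for the product [k n], whence the twist by [l^-1]
   in the multiplication: [k n l m = (k l) (l^-1 n l) m]. *)
Record sdprod (K N : groupType) (phi : group_action K N) :=
  SdPair { sd_left : K; sd_right : N }.

Section Semidirect.
Variables (K N : groupType) (phi : group_action K N).

Definition sd_to_pair (x : sdprod phi) := (sd_left x, sd_right x).
Definition sd_of_pair (x : K * N) : sdprod phi := SdPair phi x.1 x.2.

Lemma sd_to_pairK : cancel sd_to_pair sd_of_pair.
Proof. by case. Qed.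

HB.instance Definition _ := Choice.copy (sdprod phi) (can_type sd_to_pairK).

Definition sd_one : sdprod phi := SdPair phi 1%g 1%g.

Definition sd_mul (x y : sdprod phi) : sdprod phi :=
  SdPair phi (sd_left x * sd_left y)%g
             (phi (sd_left y)^-1%g (sd_right x) * sd_right y)%g.

Definition sd_inv (x : sdprod phi) : sdprod phi :=
  SdPair phi (sd_left x)^-1%g (phi (sd_left x) (sd_right x)^-1%g).

Lemma act1 k : phi k 1%g = 1%g.
Proof. by apply: (@mulgI _ (phi k 1%g)); rewrite -gact_fun_mul !mulg1. Qed.

Lemma sd_mulA : associative sd_mul.
Proof.
case=> [k a] [l b] [m c]; rewrite /sd_mul /=.
by rewrite mulgA invgM gact_funM gact_fun_mul mulgA.
Qed.

Lemma sd_mul1 : left_id sd_one sd_mul.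
Proof. by case=> [k a]; rewrite /sd_mul /sd_one /= act1 !mul1g. Qed.

Lemma sd_1mul : right_id sd_one sd_mul.
Proof. by case=> [k a]; rewrite /sd_mul /sd_one /= invg1 gact_fun1 !mulg1. Qed.

Lemma sd_mulV : left_inverse sd_one sd_inv sd_mul.
Proof.
case=> [k a]; rewrite /sd_mul /= -gact_funM mulVg gact_fun1.
by rewrite mulVg.
Qed.

Lemma sd_Vmul : right_inverse sd_one sd_inv sd_mul.
Proof.
by case=> [k a]; rewrite /sd_mul /= invgK -gact_fun_mul !mulgV act1.
Qed.

HB.instance Definition _ := isGroup.Build (sdprod phi)
  sd_mulA sd_mul1 sd_1mul sd_mulV sd_Vmul.

Definition sd_inl (k : K) : sdprod phi := SdPair phi k 1%g.
Definition sd_inr (n : N) : sdprod phi := SdPair phi 1%g n.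

Lemma sd_inlM k l : sd_inl (k * l)%g = (sd_inl k * sd_inl l)%g.
Proof. by congr SdPair; rewrite /= act1 mulg1. Qed.

Lemma sd_inrM m n : sd_inr (m * n)%g = (sd_inr m * sd_inr n)%g.
Proof. by congr SdPair; rewrite /= ?mulg1 // invg1 gact_fun1. Qed.

Lemma sd_conj k n :
  (sd_inl k * sd_inr n * (sd_inl k)^-1)%g = sd_inr (phi k n).
Proof.
congr SdPair; rewrite /= ?mulg1 ?mulgV //.
by rewrite invgK !invg1 gact_fun1 act1 mul1g mulg1.
Qed.

End Semidirect.

(** * First homology of a group with twisted coefficients *)

Record gmodule (G : groupType) := GModule {
  gm_carrier :> zmodType;
  gm_act : G -> gm_carrier -> gm_carrier;
  gm_act1 : forall m, gm_act 1%g m = m;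
  gm_actM : forall g h m, gm_act (g * h)%g m = gm_act g (gm_act h m);
  gm_actB : forall g m n, gm_act g (m - n) = gm_act g m - gm_act g n
}.

Section MalgLift.
Variables (K : choiceType) (M V : zmodType) (f : K -> {additive M -> V}).

Definition malg_lift (c : {malg M[K]}) : V :=
  \sum_(k <- msupp c) f k c@_k.

Lemma malg_liftEw (c : {malg M[K]}) (D : {fset K}) : (msupp c `<=` D)%fset ->
  malg_lift c = \sum_(k <- D) f k c@_k.
Proof.
move=> cD; rewrite /malg_lift; apply/(big_fset_incl _ cD).
by move=> k _ /mcoeff_outdom ->; rewrite raddf0.
Qed.

Lemma malg_lift_is_zmod_morphism : zmod_morphism malg_lift.
Proof.
move=> c d; pose D := (msupp c `|` msupp d)%fset.
rewrite (@malg_liftEw _ D) ?msuppB_le // (@malg_liftEw c D) ?fsubsetUl //.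
rewrite (@malg_liftEw d D) ?fsubsetUr // -sumrB.
by apply: eq_bigr => k _; rewrite mcoeffB raddfB.
Qed.

HB.instance Definition _ :=
  GRing.isZmodMorphism.Build {malg M[K]} V malg_lift
    malg_lift_is_zmod_morphism.

Lemma malg_liftU k m : malg_lift << m *g k >> = f k m.
Proof. by rewrite (malg_liftEw msuppU_le) big_seq_fset1 mcoeffUU. Qed.

End MalgLift.

(* The complex [M (x)_G (bar resolution)] in degrees 0, 1, 2, the left
   [G]-module [M] being made into a right one by [m g := g^-1 m]. A chain
   [<< m *g g >>] is [m (x) [g]], and [<< m *g (g, h) >>] is [m (x) [g|h]];
   [d [g] = g - 1] and [d [g|h] = g [h] - [g h] + [g]]. *)
Section Homology.
Variables (G : groupType) (M : gmodule G).

Definition bar1 (g : G) (m : M) : M := gm_act g^-1%g m - m.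

Lemma bar1_is_zmod_morphism g : zmod_morphism (bar1 g).
Proof. by move=> m n; rewrite /bar1 gm_actB !opprD !opprK addrACA. Qed.

HB.instance Definition _ g :=
  GRing.isZmodMorphism.Build M M (bar1 g) (bar1_is_zmod_morphism g).

Definition bar2 (x : G * G) (m : M) : {malg M[G]} :=
  << gm_act x.1^-1%g m *g x.2 >> - << m *g (x.1 * x.2)%g >> + << m *g x.1 >>.

Lemma bar2_is_zmod_morphism x : zmod_morphism (bar2 x).
Proof.
move=> m n; rewrite /bar2 gm_actB !raddfB /= !opprD !opprK.
by rewrite [X in X + _ = _]addrACA; rewrite [LHS]addrACA.
Qed.

HB.instance Definition _ x :=
  GRing.isZmodMorphism.Build M {malg M[G]} (bar2 x) (bar2_is_zmod_morphism x).

Definition d1 : {malg M[G]} -> M := malg_lift bar1.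
Definition d2 : {malg M[(G * G)%type]} -> {malg M[G]} := malg_lift bar2.

HB.instance Definition _ := GRing.Additive.on d1.
HB.instance Definition _ := GRing.Additive.on d2.

Lemma d1_d2 c : d1 (d2 c) = 0.
Proof.
rewrite /d2 {1}/malg_lift raddf_sum big1 // => -[g h] _.
rewrite /= /bar2 raddfD raddfB /= /d1 !malg_liftU /= /bar1 invgM gm_actM.
by rewrite opprB addrC [X in _ + X]addrC [X in _ + X]addrA subrK addrA subrK subrr.
Qed.

Definition cycle_pred : {pred {malg M[G]}} := fun c => d1 c == 0.

Lemma cycle_zmod_closed : zmod_closed cycle_pred.
Proof.
split=> [|x y /eqP dx /eqP dy]; rewrite /in_mem /= /cycle_pred ?raddf0 //.
by rewrite raddfB /= dx dy subr0.
Qed.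

HB.instance Definition _ :=
  GRing.isZmodClosed.Build {malg M[G]} cycle_pred cycle_zmod_closed.

Record cycle1 := Cycle1 { cycle1_val :> {malg M[G]}; _ : cycle1_val \in cycle_pred }.

HB.instance Definition _ := [isSub for cycle1_val].
HB.instance Definition _ := [Choice of cycle1 by <:].
HB.instance Definition _ := [SubChoice_isSubZmodule of cycle1 by <:].

Definition boundary_pred : {pred cycle1} :=
  fun z => `[< exists b : {malg M[(G * G)%type]}, d2 b = val z >].

Lemma boundary_zmod_closed : zmod_closed boundary_pred.
Proof.
split; first by apply/asboolP; exists 0; rewrite !raddf0.
move=> x y /asboolP[b Eb] /asboolP[c Ec]; apply/asboolP.
by exists (b - c); rewrite !raddfB /= Eb Ec.
Qed.

HB.instance Definition _ :=
  GRing.isZmodClosed.Build cycle1 boundary_pred boundary_zmod_closed.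

Definition homology1 : zmodType := Quotient.quot boundary_pred.

End Homology.

Definition zmod_isog (U V : zmodType) : Prop :=
  exists f : {additive U -> V}, bijective f.

(** * The braid group B(2e,e,r) and its sign representation *)

(* Indices live in ['Z_r], which is Z/r as soon as [1 < r]. *)
Inductive affineA_rel (r : nat) : word 'Z_r -> word 'Z_r -> Prop :=
| AffineBraid (i : 'Z_r) :
    affineA_rel [:: letter i; letter (i + 1); letter i]
                [:: letter (i + 1); letter i; letter (i + 1)]
| AffineComm (i j : 'Z_r) : j != i -> j != i + 1 -> j != i - 1 ->
    affineA_rel [:: letter i; letter j] [:: letter j; letter i].

Definition artin_affineA (r : nat) : groupType := presented (@affineA_rel r).

Definition artin_gen (r : nat) (i : 'Z_r) : artin_affineA r :=
  pres_gen (@affineA_rel r) i.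

Lemma artin_shift_subproof r (k : 'Z_r) u v : affineA_rel u v ->
  word_eval (fun i => artin_gen (i + k)) u =
  word_eval (fun i => artin_gen (i + k)) v.
Proof.
case=> [i|i j ji ji1 ji2]; rewrite /artin_gen
  !(word_eval_gen _ (fun i : 'Z_r => i + k)); apply/pres_wordP/PresRel => /=.
  by rewrite addrAC; apply: AffineBraid.
apply: AffineComm; first by rewrite (inj_eq (addIr _)).
  by rewrite addrAC (inj_eq (addIr _)).
by rewrite addrAC (inj_eq (addIr _)).
Qed.

(* The automorphism [sigma_i |-> sigma_(i + k)]. *)
Definition artin_shift r (k : 'Z_r) : artin_affineA r -> artin_affineA r :=
  @pres_lift _ (@affineA_rel r) _ (fun i : 'Z_r => artin_gen (i + k)).

Lemma artin_shiftM r (k : 'Z_r) x y :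
  artin_shift k (x * y)%g = (artin_shift k x * artin_shift k y)%g.
Proof. exact/pres_liftM/artin_shift_subproof. Qed.

Lemma artin_shift_gen r (k i : 'Z_r) :
  artin_shift k (artin_gen i) = artin_gen (i + k).
Proof. exact/pres_lift_gen/artin_shift_subproof. Qed.

Lemma artin_shift1 r (k : 'Z_r) : artin_shift k 1%g = 1%g.
Proof.
by apply: (@mulgI _ (artin_shift k 1%g)); rewrite -artin_shiftM !mulg1.
Qed.

Lemma artin_shiftV r (k : 'Z_r) x :
  artin_shift k x^-1%g = ((artin_shift k x)^-1)%g.
Proof.
by apply: (@mulgI _ (artin_shift k x)); rewrite -artin_shiftM !mulgV artin_shift1.
Qed.

Lemma artin_shift0 r x : @artin_shift r 0 x = x.
Proof.
elim/pres_ind: x => [|i y IH|i y IH]; first exact: artin_shift1.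
  by rewrite artin_shiftM artin_shift_gen addr0 IH.
by rewrite artin_shiftM artin_shiftV artin_shift_gen addr0 IH.
Qed.

Lemma artin_shiftD r (k l : 'Z_r) x :
  artin_shift (k + l) x = artin_shift k (artin_shift l x).
Proof.
have E i : i + (k + l) = i + l + k by rewrite addrAC addrA.
elim/pres_ind: x => [|i y IH|i y IH]; first by rewrite !artin_shift1.
  by rewrite !artin_shiftM !artin_shift_gen E IH.
by rewrite !artin_shiftM !artin_shiftV !artin_shift_gen E IH.
Qed.

(* [Algebra.to_multiplicative int] is the infinite cyclic group; its element [m] is
   written [(tau^e)^m]. *)
Definition tau_act e r (m : Algebra.to_multiplicative int) :
    artin_affineA r -> artin_affineA r :=
  artin_shift ((m : int)%:~R * e%:R : 'Z_r).

Lemma tau_act1 e r x : @tau_act e r 1%g x = x.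
Proof. by rewrite /tau_act mul0r artin_shift0. Qed.

Lemma tau_actM e r k l x :
  @tau_act e r (k * l)%g x = @tau_act e r k (@tau_act e r l x).
Proof. by rewrite /tau_act -artin_shiftD -mulrDl -intrD. Qed.

Lemma tau_act_mul e r k x y :
  @tau_act e r k (x * y)%g = (tau_act e k x * tau_act e k y)%g.
Proof. exact: artin_shiftM. Qed.

Definition tau_action e r :
    group_action (Algebra.to_multiplicative int) (artin_affineA r) :=
  GroupAction (@tau_act1 e r) (@tau_actM e r) (@tau_act_mul e r).

Definition braidB e r : groupType := sdprod (tau_action e r).

Definition tau_e e r : braidB e r := sd_inl (tau_action e r) (1 : int).

Definition sigma e r (i : 'Z_r) : braidB e r :=
  sd_inr (tau_action e r) (artin_gen i).

Lemma tau_sigma e r (i : 'Z_r) :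
  (tau_e e r * sigma e i * (tau_e e r)^-1)%g = sigma e (i + e%:R).
Proof. by rewrite sd_conj /= /tau_act artin_shift_gen mul1r. Qed.

Definition unit_group (R : unitRingType) : Type := {x : R | x \is a GRing.unit}.

Section UnitGroup.
Variable R : unitRingType.
Implicit Types x y z : unit_group R.

HB.instance Definition _ := Choice.on (unit_group R).

Definition ug_one : unit_group R := exist _ 1 (unitr1 R).
Definition ug_mul x y : unit_group R :=
  exist _ (val x * val y) (rpredM (valP x) (valP y)).
Definition ug_inv x : unit_group R :=
  exist _ (val x)^-1 (rpredVr (valP x)).

Lemma ug_mulA : associative ug_mul.
Proof. by move=> x y z; apply/val_inj; rewrite /= mulrA. Qed.
Lemma ug_mul1 : left_id ug_one ug_mul.
Proof. by move=> x; apply/val_inj; rewrite /= mul1r. Qed.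
Lemma ug_1mul : right_id ug_one ug_mul.
Proof. by move=> x; apply/val_inj; rewrite /= mulr1. Qed.
Lemma ug_mulV : left_inverse ug_one ug_inv ug_mul.
Proof. by move=> x; apply/val_inj; rewrite /= mulVr // (valP x). Qed.
Lemma ug_Vmul : right_inverse ug_one ug_inv ug_mul.
Proof. by move=> x; apply/val_inj; rewrite /= mulrV // (valP x). Qed.

HB.instance Definition _ := isGroup.Build (unit_group R)
  ug_mulA ug_mul1 ug_1mul ug_mulV ug_Vmul.

End UnitGroup.

(* The group {+1, -1}, as the group of units of Z. *)
Definition sign_group : groupType := unit_group int.

Definition sign_m1 : sign_group := exist _ (-1 : int) (unitrN1 int).

Lemma artin_sign_subproof r u v : @affineA_rel r u v ->
  word_eval (fun=> sign_m1) u = word_eval (fun=> sign_m1) v.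
Proof. by case=> [i|i j _ _ _]; rewrite /word_eval !big_cons !big_nil. Qed.

Definition artin_sign r : artin_affineA r -> sign_group :=
  @pres_lift _ (@affineA_rel r) _ (fun=> sign_m1).

Lemma artin_signM r x y :
  @artin_sign r (x * y)%g = (artin_sign x * artin_sign y)%g.
Proof. exact/pres_liftM/artin_sign_subproof. Qed.

Lemma artin_sign_gen r i : @artin_sign r (artin_gen i) = sign_m1.
Proof. exact/pres_lift_gen/artin_sign_subproof. Qed.

Lemma artin_sign1 r : @artin_sign r 1%g = 1%g.
Proof.
by apply: (@mulgI _ (@artin_sign r 1%g)); rewrite -artin_signM !mulg1.
Qed.

Lemma artin_signV r x : @artin_sign r x^-1%g = ((artin_sign x)^-1)%g.
Proof.
by apply: (@mulgI _ (artin_sign x)); rewrite -artin_signM !mulgV artin_sign1.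
Qed.

Lemma artin_sign_shift r (k : 'Z_r) x : artin_sign (artin_shift k x) = artin_sign x.
Proof.
elim/pres_ind: x => [|i y IH|i y IH]; first by rewrite artin_shift1.
  by rewrite artin_shiftM !artin_signM IH artin_shift_gen !artin_sign_gen.
by rewrite artin_shiftM !artin_signM IH artin_shiftV !artin_signV
  artin_shift_gen !artin_sign_gen.
Qed.

Definition epsilon e r (b : braidB e r) : sign_group := artin_sign (sd_right b).

Lemma epsilon_sigma e r (i : 'Z_r) : epsilon (sigma e i) = sign_m1.
Proof. exact: artin_sign_gen. Qed.

Lemma epsilon_tau e r : epsilon (tau_e e r) = 1%g.
Proof. exact: artin_sign1. Qed.

Lemma epsilonM e r (a b : braidB e r) :
  epsilon (a * b)%g = (epsilon a * epsilon b)%g.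
Proof. by rewrite /epsilon artin_signM artin_sign_shift. Qed.

Lemma epsilon1 e r : epsilon (1%g : braidB e r) = 1%g.
Proof. exact: artin_sign1. Qed.

Definition Z_eps_act e r (b : braidB e r) (m : int) : int := val (epsilon b) * m.

Lemma Z_eps_act1 e r m : Z_eps_act (1%g : braidB e r) m = m.
Proof. by rewrite /Z_eps_act epsilon1 mul1r. Qed.

Lemma Z_eps_actM e r (a b : braidB e r) m :
  Z_eps_act (a * b)%g m = Z_eps_act a (Z_eps_act b m).
Proof. by rewrite /Z_eps_act epsilonM mulrA. Qed.

Lemma Z_eps_actB e r (a : braidB e r) m n :
  Z_eps_act a (m - n) = Z_eps_act a m - Z_eps_act a n.
Proof. exact: mulrBr. Qed.

Definition Z_eps e r : gmodule (braidB e r) :=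
  GModule (@Z_eps_act1 e r) (@Z_eps_actM e r) (@Z_eps_actB e r).

(* Main.v *)
(* Call D : B -> A crossed when D (g h) = D g + epsilon(g) D h. Writing
   epsilon = 1 - 2 k, the chain [g] - k(g) [sigma_0] is a cycle, and its class
   is a crossed homomorphism of B vanishing at sigma_0; it is universal among
   these, so H_1 represents the functor A |-> {D | D sigma_0 = 0}. A crossed
   homomorphism is determined by s_i = D sigma_i and t = D tau^e, and the
   presentation of B turns into the linear conditions
     3 (s_(i+1) - s_i) = 0,   2 (s_j - s_i) = 0 for commuting sigma_i, sigma_j,
     s_(i+e) = s_i + 2 t,     s_0 = 0.
   H_1 is thus the abelian group given by these relations. *)
Require Import Defs.
From HB Require Import structures.
From mathcomp Require Import all_boot all_order all_algebra.
From mathcomp Require Import ring_quotient finmap boolp monalg zify ring.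

Set Implicit Arguments.
Unset Strict Implicit.
Unset Printing Implicit Defensive.

Import GRing.Theory Num.Theory.
Local Open Scope ring_scope.
Local Open Scope quotient_scope.

(** * Additive maps out of groups of integral chains *)

(* Locked, as unification may otherwise diverge by evaluating the finite maps
   underlying chains. *)
HB.lock Definition free_gen (K : choiceType) (k : K) : {malg int[K]} :=
  << 1 *g k >>.

HB.lock Definition free_lift (K : choiceType) (V : zmodType) (f : K -> V)
    (c : {malg int[K]}) : V :=
  malg_lift (fun k => ( *~%R (f k) : {additive int -> V})) c.

Section FreeLift.
Variables (K : choiceType) (V : zmodType).
Implicit Types (f : K -> V) (c : {malg int[K]}).

Lemma malgU_gen (k : K) (m : int) : << m *g k >> = free_gen k *~ m.
Proof. by rewrite free_gen.unlock -raddfMz intz. Qed.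

Lemma free_genE c : c = \sum_(k <- msupp c) free_gen k *~ c@_k.
Proof. by rewrite [LHS]monalgE; under eq_bigr => k _ do rewrite malgU_gen. Qed.

Lemma free_lift_is_zmod_morphism f : zmod_morphism (free_lift f).
Proof. by move=> c d; rewrite free_lift.unlock raddfB. Qed.

HB.instance Definition _ f :=
  GRing.isZmodMorphism.Build {malg int[K]} V (free_lift f)
    (free_lift_is_zmod_morphism f).

Lemma free_lift_gen f k : free_lift f (free_gen k) = f k.
Proof. by rewrite free_lift.unlock free_gen.unlock malg_liftU. Qed.

Lemma free_liftE f c : free_lift f c = \sum_(k <- msupp c) f k *~ c@_k.
Proof. by rewrite free_lift.unlock. Qed.

End FreeLift.

(** The corrections [x *~ k i] add up to [x] times a vanishing sum. This lets the generators in a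
    cycle be replaced by corrected ones. *)
Lemma sum_mulrzB (I : Type) (s : seq I) (V : zmodType) (x : V) (y : I -> V)
    (k c : I -> int) : \sum_(i <- s) k i *~ c i = 0 ->
  \sum_(i <- s) (y i - x *~ k i) *~ c i = \sum_(i <- s) y i *~ c i.
Proof.
move=> k0; under eq_bigr => i _ do rewrite mulrzBl -mulrzA -mulrzz.
by rewrite sumrB -mulrz_sumr k0 mulr0z subr0.
Qed.

(** * The universal crossed homomorphism to the first homology *)

Section CrossedHom.
Variables (e r : nat).
Notation B := (braidB e r).
Notation M := (Z_eps e r).
Notation s0 := (sigma e (0 : 'Z_r)).

Definition crossed (A : zmodType) (D : B -> A) : Prop :=
  forall g h, D (g * h)%g = D g + D h *~ val (epsilon g).

(* The [k] with [epsilon = 1 - 2 k]. *)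
Definition sgn_idx (g : B) : int := (val (epsilon g) == -1)%:Z.

Lemma val_epsilon (g : B) : val (epsilon g) = 1 - sgn_idx g *+ 2.
Proof.
rewrite /sgn_idx; have := valP (epsilon g).
by rewrite qualifE /= => /orP[] /eqP ->.
Qed.

Lemma val_epsilonM (g h : B) :
  val (epsilon (g * h)%g) = val (epsilon g) * val (epsilon h).
Proof. by rewrite epsilonM. Qed.

Lemma val_epsilonV (g : B) : val (epsilon g^-1%g) = val (epsilon g).
Proof.
have := val_epsilonM g^-1%g g; rewrite mulVg epsilon1 /=.
by rewrite !val_epsilon /sgn_idx; do 2!case: eqP.
Qed.

(** Half of the identity 1 - epsilon(g h) = (1 - epsilon(g)) + epsilon(g) (1 - epsilon(h)). *)
Lemma crossed_sgn_idx : crossed sgn_idx.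
Proof.
move=> g h; have := val_epsilonM g h; rewrite -mulrzr intz !val_epsilon.
by lia.
Qed.

Lemma sgn_idx_sigma (i : 'Z_r) : sgn_idx (sigma e i) = 1.
Proof. by rewrite /sgn_idx epsilon_sigma. Qed.

(** The inverse in the right action disappears because signs are their own inverses, so the
    coefficient of [g] is epsilon(g) - 1 = -2 k(g). *)
Lemma d1_liftE (c : {malg int[B]}) :
  @d1 B M c = free_lift (fun g => - (sgn_idx g *+ 2)) c.
Proof.
rewrite free_liftE; apply: eq_bigr => g _ /=.
rewrite /bar1 /= /Z_eps_act val_epsilonV val_epsilon.
move: (c@_g : int) => m; rewrite -[LHS]/((1 - sgn_idx g *+ 2) * m - m).
by rewrite -mulrzr intz; ring.
Qed.

Lemma d2_liftE (c : {malg int[(B * B)%type]}) :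
  @d2 B M c = free_lift (fun x => free_gen x.2 *~ val (epsilon x.1)
                - free_gen (x.1 * x.2)%g + free_gen x.1) c.
Proof.
rewrite free_liftE; apply: eq_bigr => -[g h] _ /=.
rewrite /bar2 /= /Z_eps_act val_epsilonV.
move: (c@_(g, h) : int) => m.
rewrite mulrzDl mulrzBl -mulrzA -!malgU_gen; reflexivity.
Qed.

Definition idx_chain (g : B) : {malg int[B]} :=
  free_gen g - free_gen s0 *~ sgn_idx g.

(** The boundary of [g] is -2 k(g) and that of [sigma_0] is -2, so the correction cancels it. *)
Lemma idx_chain_cycle (g : B) : idx_chain g \in @cycle_pred B M.
Proof.
apply/eqP; rewrite d1_liftE /idx_chain raddfB raddfMz /= !free_lift_gen.
by rewrite sgn_idx_sigma -mulrzr intz; lia.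
Qed.

Definition idx_cycle (g : B) : cycle1 M := Cycle1 (idx_chain_cycle g).

Definition univ_crossed (g : B) : homology1 M := \pi_(homology1 M) (idx_cycle g).

(** The defect of the crossed rule is, up to sign, the bar boundary of [g|h]; the multiples of
    [sigma_0] cancel because [sgn_idx] is itself crossed. *)
Lemma univ_crossedP : crossed univ_crossed.
Proof.
move=> g h; rewrite /univ_crossed -raddfMz -raddfD.
apply/eqP; rewrite -Quotient.idealrBE; apply/asboolP.
exists (- free_gen (g, h)).
rewrite raddfB raddfD raddfMz d2_liftE raddfN /= free_lift_gen /= /idx_chain.
rewrite crossed_sgn_idx mulrzBl mulrzDr -mulrzA -[sgn_idx h *~ _]mulrzr intz.
rewrite -opprD [in RHS]addrACA -opprD opprB [in RHS]addrA subrK.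
by rewrite opprD opprB [in RHS]opprD addrA [RHS]addrAC.
Qed.

Lemma univ_crossed_s0 : univ_crossed s0 = 0.
Proof.
rewrite -[RHS](raddf0 \pi_(homology1 M)); congr (\pi _); apply: val_inj.
by rewrite /= /idx_chain sgn_idx_sigma mulr1z subrr.
Qed.

(** Together with additivity, this shows that the classes [univ_crossed g] generate the homology
    group. *)
Lemma cycle1_sum (z : cycle1 M) :
  z = \sum_(g <- msupp (val z)) idx_cycle g *~ (val z)@_g.
Proof.
apply: val_inj; rewrite raddf_sum; have := valP z; set c := val z.
rewrite {1}/in_mem /= /cycle_pred d1_liftE => d1c.
(* The cycle condition only gives twice this sum; the 2 can be cancelled in the integers. *)
have idx0 : \sum_(g <- msupp c) sgn_idx g *~ c@_g = 0.
  have /eqP : free_lift (fun g => - (sgn_idx g *+ 2)) c = 0 by apply/eqP.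
  rewrite free_liftE.
  under eq_bigr => g _ do rewrite mulNrz pmulrn mulrzAC -pmulrn.
  by rewrite sumrN sumrMnl oppr_eq0 mulrn_eq0 => /eqP.
transitivity (\sum_(g <- msupp c) idx_chain g *~ c@_g); last first.
  apply: eq_bigr => g _.
  exact/esym/(raddfMz (val : {additive cycle1 M -> {malg M[B]}})).
by rewrite [RHS]sum_mulrzB ?idx0 //; exact: free_genE.
Qed.

Lemma univ_crossed_gen (V : zmodType) (f1 f2 : {additive homology1 M -> V}) :
  (forall g, f1 (univ_crossed g) = f2 (univ_crossed g)) -> f1 =1 f2.
Proof.
move=> E x; rewrite -[x]reprK [repr x]cycle1_sum !raddf_sum.
by apply: eq_bigr => g _; rewrite !raddfMz; congr (_ *~ _); apply: E.
Qed.

Section Lift.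
Variables (A : zmodType) (D : B -> A) (DM : crossed D) (D0 : D s0 = 0).

(** On [g|h] the value is epsilon(g) D h - D (g h) + D g, which is zero by the crossed rule. Hence
    the extension of [D] to chains descends to homology. *)
Lemma free_lift_d2 (c : {malg int[(B * B)%type]}) :
  free_lift D (@d2 B M c) = 0.
Proof.
rewrite d2_liftE [c]free_genE !raddf_sum big1 // => -[g h] _ /=.
rewrite !raddfMz /= free_lift_gen /= raddfD raddfB /= raddfMz /= !free_lift_gen DM.
by rewrite opprD addrCA subrr addr0 addNr mul0rz.
Qed.

Definition crossed_lift (x : homology1 M) : A := free_lift D (val (repr x)).

Lemma crossed_liftE (z : cycle1 M) :
  crossed_lift (\pi_(homology1 M) z) = free_lift D (val z).
Proof.
have /asboolP[b Eb] : repr (\pi_(homology1 M) z) - z \in @boundary_pred B M.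
  by rewrite Quotient.idealrBE reprK.
apply: subr0_eq; rewrite /crossed_lift -raddfB -[RHS](free_lift_d2 b) Eb.
by congr free_lift; exact/esym/(raddfB (val : {additive cycle1 M -> _})).
Qed.

Lemma crossed_lift_is_zmod_morphism : zmod_morphism crossed_lift.
Proof.
move=> x y; rewrite -[x]reprK -[y]reprK -raddfB /= !crossed_liftE.
by rewrite !raddfB.
Qed.

HB.instance Definition _ :=
  GRing.isZmodMorphism.Build (homology1 M) A crossed_lift
    crossed_lift_is_zmod_morphism.

(** The lift takes the class of g to D g - k(g) D sigma_0, whence the normalization [D0]. *)
Lemma univ_crossed_factor :
  exists f : {additive homology1 M -> A}, forall g, f (univ_crossed g) = D g.
Proof.
exists crossed_lift => g.
rewrite /= crossed_liftE /= /idx_chain raddfB raddfMz /= !free_lift_gen D0.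
by rewrite mul0rz subr0.
Qed.

End Lift.
End CrossedHom.

(** * Construction of crossed homomorphisms from solutions of the linear conditions *)

(* [(a, x)] is the affine map [y |-> x + a y] of [A]; a crossed homomorphism is
   the same as a homomorphism to this group lifting the sign. *)
Definition sign_affine (A : zmodType) : Type := (sign_group * A)%type.

Section SignAffine.
Variable A : zmodType.
Implicit Types x y z : sign_affine A.

HB.instance Definition _ := Choice.on (sign_affine A).

Definition sa_one : sign_affine A := (1%g, 0).
Definition sa_mul x y : sign_affine A :=
  ((x.1 * y.1)%g, x.2 + y.2 *~ val x.1).
Definition sa_inv x : sign_affine A := ((x.1)^-1%g, - (x.2 *~ val (x.1)^-1%g)).

Lemma sa_mulA : associative sa_mul.
Proof.
move=> x y z; rewrite /sa_mul /= mulgA; congr pair.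
by rewrite mulrzDl -mulrzA mulrC addrA.
Qed.

Lemma sa_mul1 : left_id sa_one sa_mul.
Proof. by case=> a x; rewrite /sa_mul /= mul1g add0r mulr1z. Qed.

Lemma sa_1mul : right_id sa_one sa_mul.
Proof. by case=> a x; rewrite /sa_mul /= mulg1 mul0rz addr0. Qed.

Lemma sa_mulV : left_inverse sa_one sa_inv sa_mul.
Proof. by case=> a x; rewrite /sa_mul /= mulVg addNr. Qed.

Lemma sa_Vmul : right_inverse sa_one sa_inv sa_mul.
Proof.
case=> a x; rewrite /sa_mul /= mulgV mulNrz -mulrzA.
by rewrite mulVr ?(valP a) // mulr1z subrr.
Qed.

HB.instance Definition _ := isGroup.Build (sign_affine A)
  sa_mulA sa_mul1 sa_1mul sa_mulV sa_Vmul.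

Lemma sa_mulE x y : (x * y)%g = ((x.1 * y.1)%g, x.2 + y.2 *~ val x.1).
Proof. by []. Qed.

Definition sa_trans (t : A) : sign_affine A := (1%g, t).

Lemma sa_transD t u : sa_trans (t + u) = (sa_trans t * sa_trans u)%g.
Proof. by rewrite sa_mulE /= mulg1 mulr1z. Qed.

Lemma sa_transN t : sa_trans (- t) = ((sa_trans t)^-1)%g.
Proof. by apply: (@mulgI _ (sa_trans t)); rewrite -sa_transD subrr mulgV. Qed.

End SignAffine.

Record braid_data e r (A : zmodType) (s : 'Z_r -> A) (t : A) : Prop := BraidData {
  bd_zero : s 0 = 0;
  bd_braid : forall i, s (i + 1) *+ 3 = s i *+ 3;
  bd_comm : forall i j, j != i -> j != i + 1 -> j != i - 1 -> s j *+ 2 = s i *+ 2;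
  bd_tau : forall i, s (i + e%:R) = s i + t *+ 2
}.

Section Realize.
Variables (e r : nat) (A : zmodType) (s : 'Z_r -> A) (t : A).
Hypothesis st : braid_data e s t.
Notation B := (braidB e r).

Definition sa_sigma (i : 'Z_r) : sign_affine A := (sign_m1, s i).

(** With x = s_i and y the value at the other index, the two sides of the braid relation translate
    by 2x - y = 3x - (x + y) and 2y - x = 3y - (x + y); those of a commutation, by x - y = 2x - (x +
    y) and y - x = 2y - (x + y). *)
Lemma sa_sigma_rel u v : @affineA_rel r u v ->
  word_eval sa_sigma u = word_eval sa_sigma v.
Proof.
case=> [i|i j ji ji1 ji2]; rewrite /word_eval !big_cons !big_nil /= !mulg1.
  rewrite !sa_mulE /= !mulrN1z; congr pair.
  have E (x y : A) : x + (x - y) = x *+ 3 - (x + y).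
    by rewrite mulrSr opprD [RHS]addrA addrK mulr2n addrA.
  by rewrite !opprB !E (bd_braid st) [s i + _]addrC.
rewrite !sa_mulE /= !mulrN1z; congr pair.
have E (x y : A) : x - y = x *+ 2 - (x + y).
  by rewrite mulr2n opprD addrACA subrr add0r.
by rewrite [LHS]E [RHS]E (bd_comm st ji ji1 ji2) [s i + _]addrC.
Qed.

Definition artin_sa : artin_affineA r -> sign_affine A :=
  @pres_lift _ (@affineA_rel r) _ sa_sigma.

Lemma artin_saM x y : artin_sa (x * y)%g = (artin_sa x * artin_sa y)%g.
Proof. exact/pres_liftM/sa_sigma_rel. Qed.

Lemma artin_sa1 : artin_sa 1%g = 1%g.
Proof. by apply: (@mulgI _ (artin_sa 1%g)); rewrite -artin_saM !mulg1. Qed.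

Lemma artin_saV x : artin_sa x^-1%g = ((artin_sa x)^-1)%g.
Proof. by apply: (@mulgI _ (artin_sa x)); rewrite -artin_saM !mulgV artin_sa1. Qed.

Lemma artin_sa_gen i : artin_sa (artin_gen i) = sa_sigma i.
Proof. exact/pres_lift_gen/sa_sigma_rel. Qed.

Lemma artin_sa_sign x : (artin_sa x).1 = artin_sign x.
Proof.
elim/pres_ind: x => [|i y IH|i y IH]; first by rewrite artin_sa1 artin_sign1.
  by rewrite artin_saM artin_signM -IH artin_sa_gen artin_sign_gen.
by rewrite artin_saM artin_signM artin_saV artin_signV -IH artin_sa_gen
  artin_sign_gen.
Qed.

Lemma bd_tauz (l : int) i : s (i + l%:~R * e%:R) = s i + t *~ l *+ 2.
Proof.
elim/int_rect: l i => [|n IH|n IH] i.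
- by rewrite mul0r mulr0z mul0rn !addr0.
- rewrite -addn1 PoszD !mulrzDr !mulr1z mulrDl mul1r addrA (bd_tau st) IH.
  by rewrite mulrnDl [RHS]addrA.
apply: (@addIr _ (t *+ 2)); rewrite -(bd_tau st) -addn1 PoszD opprD.
rewrite !mulrzDr !mulrN1z mulrDl mulN1r addrA subrK IH.
by rewrite mulrnDl mulNrn -[RHS]addrA subrK.
Qed.

(* Conjugation by the translation of vector [t] moves [s_i] by [2 t], as does the
   shift of indices by [e]. *)
Lemma artin_sa_tau (l : int) x :
  artin_sa (artin_shift (l%:~R * e%:R) x) =
  (sa_trans (t *~ l) * artin_sa x * (sa_trans (t *~ l))^-1)%g.
Proof.
set c := sa_trans _.
have sc i : sa_sigma (i + l%:~R * e%:R) = (c * sa_sigma i * c^-1)%g.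
  rewrite /sa_sigma bd_tauz -sa_transN !sa_mulE /= mul1g mulg1 mulr1z.
  by rewrite mulrN1z opprK addrAC addrC mulr2n.
elim/pres_ind: x => [|i y IH|i y IH].
- by rewrite artin_shift1 artin_sa1 mulg1 mulgV.
- rewrite artin_shiftM !artin_saM IH artin_shift_gen !artin_sa_gen sc.
  by rewrite !mulgA mulgVK.
rewrite artin_shiftM !artin_saM IH artin_shiftV artin_shift_gen.
by rewrite !artin_saV !artin_sa_gen sc !invgM invgK !mulgA mulgVK.
Qed.

Definition braid_sa (b : B) : sign_affine A :=
  (sa_trans (t *~ sd_left b) * artin_sa (sd_right b))%g.

(** The twist by the inverse of [l] in the product of pairs becomes conjugation by a translation,
    that is [artin_sa_tau] at [- l]. *)
Lemma braid_saM g h : braid_sa (g * h)%g = (braid_sa g * braid_sa h)%g.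
Proof.
case: g h => [k a] [l b]; rewrite /braid_sa /= /tau_act artin_saM.
rewrite (artin_sa_tau (- (l : int))) mulrzDr sa_transD mulrNz sa_transN invgK.
by rewrite !mulgA mulgK.
Qed.

Definition braid_crossed (b : B) : A := (braid_sa b).2.

Lemma braid_sa_sign b : (braid_sa b).1 = epsilon b.
Proof. by rewrite /braid_sa sa_mulE /= mul1g artin_sa_sign. Qed.

Lemma braid_crossedP : crossed braid_crossed.
Proof. by move=> g h; rewrite /braid_crossed braid_saM sa_mulE -braid_sa_sign. Qed.

Lemma braid_crossed_sigma i : braid_crossed (sigma e i) = s i.
Proof.
by rewrite /braid_crossed /braid_sa /= artin_sa_gen mulr0z add0r mulr1z.
Qed.

Lemma braid_crossed_tau : braid_crossed (tau_e e r) = t.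
Proof. by rewrite /braid_crossed /braid_sa /= artin_sa1 mul0rz addr0. Qed.

End Realize.

(** * Necessity of the linear conditions, and a criterion identifying the homology group *)

Section Initial.
Variables (e r : nat).
Notation B := (braidB e r).
Notation M := (Z_eps e r).
Notation s0 := (sigma e (0 : 'Z_r)).

(** A pair [(k, a)] is a power of [tau_e e r] times an element of the Artin group, so [tau_e e r]
    and the [sigma e i] generate. *)
Lemma braidB_ind (P : B -> Prop) :
    P 1%g -> (forall g h, P g -> P h -> P (g * h)%g) ->
    (forall g, P g -> P g^-1%g) ->
    (forall i, P (sigma e i)) -> P (tau_e e r) ->
  forall g, P g.
Proof.
move=> P1 PM PV Ps Pt.
have Pr a : P (sd_inr (tau_action e r) a).
  elim/pres_ind: a => [//|i y IH|i y IH]; rewrite sd_inrM; apply: PM => //.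
    exact: Ps.
  have -> : sd_inr (tau_action e r) (artin_gen i)^-1%g = ((sigma e i)^-1)%g.
    by apply: (@mulgI _ (sigma e i)); rewrite -sd_inrM !mulgV.
  exact/PV/Ps.
have Pn (n : nat) : P (sd_inl (tau_action e r) (n : int)).
  elim: n => [//|n IH].
  rewrite (_ : sd_inl _ _ = (tau_e e r * sd_inl (tau_action e r) (n : int))%g).
    exact: PM.
  exact: (sd_inlM (tau_action e r) (1 : int) (n : int)).
have Pl (k : int) : P (sd_inl (tau_action e r) k).
  elim/int_rect: k => [|n _|n _]; [exact: Pn|exact: Pn|].
  rewrite (_ : sd_inl _ _ = (sd_inl (tau_action e r) (n.+1 : int))^-1%g).
    exact/PV/Pn.
  apply: (@mulgI _ (sd_inl (tau_action e r) (n.+1 : int))).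
  rewrite mulgV -sd_inlM.
  (* The group law on the multiplicative copy of the integers is addition. *)
  by congr sd_inl; apply: (subrr (n.+1 : int)).
case=> k a; rewrite (_ : SdPair _ k a = sd_inl (tau_action e r) k * sd_inr _ a)%g.
  exact: PM.
congr SdPair; first exact/esym/mulg1.
by rewrite [X in (X * _)%g](act1 (tau_action e r)) mul1g.
Qed.

Section Crossed.
Variables (A : zmodType) (D : B -> A) (DM : crossed D).

Lemma crossed1 : D 1%g = 0.
Proof.
apply: (@addrI _ (D 1%g)); rewrite addr0.
by have := DM 1%g 1%g; rewrite mulg1 epsilon1 mulr1z.
Qed.

Lemma crossedV g : D g^-1%g = - D g *~ val (epsilon g).
Proof.
have /eqP := DM g^-1%g g; rewrite mulVg crossed1 val_epsilonV eq_sym addr_eq0.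
by move=> /eqP ->; rewrite mulNrz.
Qed.

Lemma crossed_sigmaM (i : 'Z_r) g : D (sigma e i * g)%g = D (sigma e i) - D g.
Proof. by rewrite DM epsilon_sigma mulrN1z. Qed.

(** Folds a product of generators into the image of one word, to which the relations of the Artin
    group apply. *)
Lemma sigma_consM (i : 'Z_r) u :
  (sigma e i * sd_inr (tau_action e r) (pres_word (@affineA_rel r) u))%g =
  sd_inr (tau_action e r) (pres_word (@affineA_rel r) (letter i :: u)).
Proof.
rewrite -[LHS](sd_inrM (tau_action e r) (artin_gen i) (pres_word _ u)).
by congr sd_inr; rewrite -[RHS]/(pres_word _ ([:: letter i] ++ u)) pres_wordM.
Qed.

Lemma sigma_braid (i : 'Z_r) :
  (sigma e i * (sigma e (i + 1)%R * sigma e i) =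
   sigma e (i + 1)%R * (sigma e i * sigma e (i + 1)%R))%g.
Proof.
rewrite (sigma_consM (i + 1) [:: letter i]) (sigma_consM i [:: letter (i + 1)]).
rewrite !sigma_consM; congr sd_inr; apply/pres_wordP; apply: PresRel.
exact: AffineBraid.
Qed.

Lemma sigma_comm (i j : 'Z_r) : j != i -> j != i + 1 -> j != i - 1 ->
  (sigma e i * sigma e j = sigma e j * sigma e i)%g.
Proof.
move=> ji ji1 ji2; rewrite (sigma_consM i [:: letter j]).
rewrite (sigma_consM j [:: letter i]); congr sd_inr; apply/pres_wordP.
by apply: PresRel; apply: AffineComm.
Qed.

(** Apply [D] to each relation. Adding x + y to both sides of x - (y - x) = y - (x - y) gives 3x =
    3y, and adding it to x - y = y - x gives 2x = 2y. The action of tau^e is used in the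
    inverse-free form sigma_(i+e) tau^e = tau^e sigma_i. *)
Lemma crossed_data : D s0 = 0 ->
  braid_data e (fun i : 'Z_r => D (sigma e i)) (D (tau_e e r)).
Proof.
move=> D0; split=> // [i|i j ji ji1 ji2|i].
- cbv beta; have := congr1 D (sigma_braid i); rewrite !crossed_sigmaM.
  move: (D (sigma e i)) (D (sigma e (i + 1)%R)) => x y E.
  have F (u v : A) : u - (v - u) + (u + v) = u *+ 3.
    by rewrite opprB addrA addrAC addrA addrNK addrC -mulr2n -mulrS.
  by rewrite -(F x y) -(F y x) E [y + x]addrC.
- cbv beta; have := congr1 D (sigma_comm ji ji1 ji2); rewrite !crossed_sigmaM.
  move: (D (sigma e i)) (D (sigma e j)) => x y E.
  have F (u v : A) : u - v + (u + v) = u *+ 2 by rewrite addrACA addNr addr0.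
  by rewrite -(F x y) -(F y x) E [y + x]addrC.
have /(congr1 D) : (sigma e (i + e%:R)%R * tau_e e r = tau_e e r * sigma e i)%g.
  by rewrite -tau_sigma mulgVK.
rewrite crossed_sigmaM DM epsilon_tau mulr1z => /(canRL (subrK _)) ->.
by rewrite addrAC addrC mulr2n.
Qed.

End Crossed.

Lemma crossed_ext (A : zmodType) (D D' : B -> A) : crossed D -> crossed D' ->
    (forall i, D (sigma e i) = D' (sigma e i)) -> D (tau_e e r) = D' (tau_e e r) ->
  D =1 D'.
Proof.
move=> DM DM' Ds Dt; apply: braidB_ind => //.
- by rewrite !crossed1.
- by move=> g h Eg Eh; rewrite DM DM' Eg Eh.
by move=> g Eg; rewrite !crossedV // Eg.
Qed.

(** Two universal objects are isomorphic: [f] comes from the universality of the homology group and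
    [L] from that of [A]. [L \o f] fixes the generating classes, and [f \o L] fixes the data [s],
    [t], so it is the identity by rigidity, which plays the part of uniqueness. *)
Lemma homology1_initial (A : zmodType) (s : 'Z_r -> A) (t : A) :
    braid_data e s t ->
    (forall (V : zmodType) (s' : 'Z_r -> V) (t' : V), braid_data e s' t' ->
       exists2 L : {additive A -> V}, forall i, L (s i) = s' i & L t = t') ->
    (forall f : {additive A -> A}, (forall i, f (s i) = s i) -> f t = t ->
       forall x, f x = x) ->
  zmod_isog (homology1 M) A.
Proof.
move=> st univ rigid.
have D0 : braid_crossed s t s0 = 0 by rewrite (braid_crossed_sigma st) (bd_zero st).
have DM := braid_crossedP st.
have UM := @univ_crossedP e r.
have [L Ls Lt] := univ _ _ _ (crossed_data UM (@univ_crossed_s0 e r)).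
have [f fE] := univ_crossed_factor DM D0.
have LD g : L (braid_crossed s t g) = univ_crossed g.
  apply: (@crossed_ext _ (L \o braid_crossed s t)) => // [g' h|i|] /=.
  - by rewrite DM raddfD raddfMz.
  - by rewrite (braid_crossed_sigma st) Ls.
  by rewrite (braid_crossed_tau st) Lt.
exists f, L => x.
  by apply: (@univ_crossed_gen _ _ _ (L \o f) idfun) => g /=; rewrite fE LD.
apply: (rigid (f \o L)) => [i|] /=.
  by rewrite Ls fE (braid_crossed_sigma st).
by rewrite Lt fE (braid_crossed_tau st).
Qed.

End Initial.

(** * Homomorphisms out of cyclic groups *)

Section CyclicLift.
Variables (m : nat) (V : zmodType) (v : V).
Hypothesis v0 : v *+ m.+2 = 0.

Definition Zp_lift (a : 'I_m.+2) : V := v *+ a.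

Lemma Zp_lift_is_zmod_morphism : zmod_morphism Zp_lift.
Proof.
have LD a b : Zp_lift (a + b) = Zp_lift a + Zp_lift b.
  rewrite /Zp_lift -mulrnDr [in RHS](divn_eq (a + b) m.+2) mulrnDr.
  by rewrite mulnC mulrnA v0 mul0rn add0r.
by move=> a b; apply: (@addIr _ (Zp_lift b)); rewrite -LD !subrK.
Qed.

Lemma Zp_liftP : exists L : {additive 'I_m.+2 -> V}, forall a, L a = v *+ a.
Proof.
pose i := GRing.isZmodMorphism.Build 'I_m.+2 V Zp_lift Zp_lift_is_zmod_morphism.
pose L : {additive 'I_m.+2 -> V} := HB.pack Zp_lift i.
by exists L.
Qed.

End CyclicLift.

Lemma Zp_additive_nat (m : nat) (V : zmodType) (f : {additive 'I_m.+2 -> V}) a :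
  f a = f 1 *+ a.
Proof. by rewrite -raddfMn natr_Zp. Qed.

Lemma Zp_natr_neq0 (r k : nat) : (0 < k < r)%N -> (k%:R : 'Z_r) != 0.
Proof.
move=> /andP[k0 kr]; apply/eqP => /(congr1 val).
by rewrite /= val_Zp_nat ?modn_small //; lia.
Qed.

Lemma Zp_natr_mod (r e c : nat) : (1 < r)%N -> (e = c %[mod r])%N ->
  e%:R = c%:R :> 'Z_r.
Proof. by move=> r1 ec; apply: val_inj; rewrite /= !val_Zp_nat. Qed.

(** * Consequences of the linear conditions *)

Section BraidDataTheory.
Variables (e r : nat) (V : zmodType) (s : 'Z_r -> V) (t : V).
Hypothesis st : braid_data e s t.

Lemma braid_data_const : (forall i, s (i + 1) = s i) -> forall i, s i = 0.
Proof.
move=> sS i; rewrite -[i]natr_Zp; elim: (i : nat) => [|n IH].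
  exact: bd_zero st.
by rewrite -natr1 sS.
Qed.

Lemma braid_data_order3 i : s i *+ 3 = 0.
Proof.
rewrite -[i]natr_Zp; elim: (i : nat) => [|n IH].
  by rewrite (bd_zero st) mul0rn.
by rewrite -natr1 (bd_braid st).
Qed.

(** Since 3 s_k = 0, doubling is negation, hence injective on these values. *)
Lemma braid_data_comm i j : j != i -> j != i + 1 -> j != i - 1 -> s j = s i.
Proof.
move=> ji ji1 ji2; apply: oppr_inj.
have E k : - s k = s k *+ 2.
  by apply/eqP; rewrite eq_sym -addr_eq0 -mulrSr braid_data_order3.
by rewrite !E (bd_comm st ji ji1 ji2).
Qed.

(** The bounds say that i and i + k are distinct and not adjacent on the cycle Z/r. *)
Lemma braid_data_shift k i : (1 < k < r.-1)%N -> s (i + k%:R) = s i.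
Proof.
(* With the shift written k + 1, the three differences are k + 1, k and k + 2, all strictly between
   0 and r. *)
case: k => [//|k] kr; apply: braid_data_comm; rewrite -subr_eq0.
- by rewrite addrAC subrr add0r Zp_natr_neq0 //; lia.
- by rewrite -natr1 opprD addrACA subrr add0r addrK Zp_natr_neq0 //; lia.
rewrite [i + _]addrC opprB -addrA [i + _]addrCA subrr addr0 natr1.
by rewrite Zp_natr_neq0 //; lia.
Qed.

End BraidDataTheory.

(** * Solution of the linear conditions for each r and e *)

Section Cases.
Variable e : nat.

(* If all [s_i] vanish, [2 t = 0] is the only relation left. *)
Lemma homology1_Z2 r :
    (forall (V : zmodType) (s : 'Z_r -> V) (t : V),
       braid_data e s t -> forall i, s i = 0) ->
  zmod_isog (homology1 (Z_eps e r)) 'Z_2.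
Proof.
move=> s0; apply: (@homology1_initial e r 'Z_2 (fun=> 0) 1).
- by split=> *; apply: val_inj.
- move=> V s t st.
  have t2 : t *+ 2 = 0.
    by have := bd_tau st 0; rewrite !(s0 _ _ _ st) add0r.
  have [L LE] := Zp_liftP t2.
  by exists L => [i|]; rewrite LE // (s0 _ _ _ st).
by move=> f _ f1 x; rewrite Zp_additive_nat f1 natr_Zp.
Qed.

(** Both 2 and 3 are now shifts between commuting generators, so s_(i+1) = s_(i+3) = s_i. *)
Lemma homology1_ge5 r : (4 < r)%N -> zmod_isog (homology1 (Z_eps e r)) 'Z_2.
Proof.
move=> r4; apply: homology1_Z2 => V s t st; apply: (braid_data_const st) => i.
rewrite -(@braid_data_shift _ _ _ _ _ st 2 (i + 1)); last by lia.
rewrite -addrA [1 + _]addrC natr1.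
by apply: (@braid_data_shift _ _ _ _ _ st 3 i); lia.
Qed.

(** Here s_(i+1) = s_i + 2t. The commuting shift by 2 gives 4t = 0 and the braid relation gives 6t =
    0, so 2t = 0 and s is constant. *)
Lemma homology1_4_1 : (e = 1 %[mod 4])%N -> zmod_isog (homology1 (Z_eps e 4)) 'Z_2.
Proof.
move=> e1; apply: homology1_Z2 => V s t st; apply: (braid_data_const st) => i.
have sS j : s (j + 1) = s j + t *+ 2.
  by rewrite -(bd_tau st) (@Zp_natr_mod 4 e 1).
have t4 : t *+ 2 + t *+ 2 = 0.
  apply: (@addrI _ (s i)); rewrite addrA -!sS -addrA addr0.
  exact: (@braid_data_shift _ _ _ _ _ st 2).
have t6 : t *+ 2 *+ 3 = 0.
  by apply: (@addrI _ (s i *+ 3)); rewrite -mulrnDl -sS (bd_braid st) addr0.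
by move: t6; rewrite mulrS mulr2n t4 addr0 sS => ->; rewrite addr0.
Qed.

(** The shift by 2 forces s_0 = s_2 = 0 and s_1 = s_3; as e is even, 2t = 0. What remains is s_1 of
    order 3 and t of order 2, realized by 2 and 3 in Z/6. *)
Lemma homology1_4_even : (e = 0 %[mod 4])%N \/ (e = 2 %[mod 4])%N ->
  zmod_isog (homology1 (Z_eps e 4)) 'Z_6.
Proof.
move=> eE.
have e02 : e%:R = 0 :> 'Z_4 \/ e%:R = 2%:R :> 'Z_4.
  by case: eE => eE; [left|right]; rewrite (Zp_natr_mod _ eE).
apply: (@homology1_initial e 4 'Z_6
  (fun i : 'Z_4 => if odd i then 2%:R else 0) 3%:R).
- split=> //.
  + by case=> [[|[|[|[|]]]] ?] //; apply: val_inj.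
  + by case=> [[|[|[|[|]]]] ?] // [[|[|[|[|]]]] ?] //.
  move=> i; case: e02 => ->; first by rewrite addr0; case: ifP => _; apply: val_inj.
  by case: i => [[|[|[|[|]]]] ?] //; apply: val_inj.
- move=> V s t st.
  have t2 : t *+ 2 = 0.
    apply: (@addrI _ (s 0)); rewrite -(bd_tau st) addr0.
    by case: e02 => ->; rewrite ?addr0 // (@braid_data_shift _ _ _ _ _ st 2).
  have s3 := braid_data_order3 st.
  (* [u = t - s_1] satisfies [2 u = s_1] and [3 u = t]. *)
  have u6 : (t - s 1) *+ 6 = 0.
    by rewrite mulrnBl (mulrnA t 2 3) (mulrnA _ 3 2) t2 s3 !mul0rn subr0.
  have [L LE] := Zp_liftP u6.
  have s20 : s 2%:R = 0.
    by rewrite -[2%:R]add0r (@braid_data_shift _ _ _ _ _ st 2) ?(bd_zero st).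
  exists L => [i|]; rewrite LE; last first.
    by rewrite /= mulrnBl s3 subr0 mulrSr t2 add0r.
  have u2 : (t - s 1) *+ 2 = s 1.
    by apply/eqP; rewrite mulrnBl t2 sub0r -subr_eq0 -opprD oppr_eq0 -mulrSr s3.
  case: i => [[|[|[|[|]]]] lti] //=.
  + by rewrite mulr0n -(bd_zero st); congr s; apply: val_inj.
  + by rewrite u2; congr s; apply: val_inj.
  + by rewrite mulr0n -s20; congr s; apply: val_inj.
  rewrite u2 -(@braid_data_shift _ _ _ _ _ st 2 1) //; congr s; exact: val_inj.
move=> f fs f3 x; have := fs 1 => /= f2.
(* Since 1 = 3 - 2, fixing 2 and 3 means fixing a generator. *)
have f1 : f 1 = 1.
  transitivity (f (3%:R - 2%:R)); first by congr (f _); apply: val_inj.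
  by rewrite raddfB f2 f3; apply: val_inj.
by rewrite Zp_additive_nat f1 natr_Zp.
Qed.

(** Here s_n = 2n t, so t generates; in Z/3 all distinct indices are adjacent, so no commutation
    condition arises. *)
Lemma homology1_3_1 : (e = 1 %[mod 3])%N -> zmod_isog (homology1 (Z_eps e 3)) 'Z_6.
Proof.
move=> e1; have eE : e%:R = 1 :> 'Z_3 by rewrite (Zp_natr_mod _ e1).
apply: (@homology1_initial e 3 'Z_6 (fun i : 'Z_3 => i.*2%:R) 1).
- split=> //.
  + by case=> [[|[|[|]]] ?] //; apply: val_inj.
  + by case=> [[|[|[|]]] ?] // [[|[|[|]]] ?] //.
  by rewrite eE; case=> [[|[|[|]]] ?] //; apply: val_inj.
- move=> V s t st.
  have sS i : s (i + 1) = s i + t *+ 2 by rewrite -(bd_tau st) eE.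
  have sE (n : nat) : s n%:R = t *+ n.*2.
    elim: n => [|n IH]; first exact: bd_zero st.
    by rewrite -natr1 sS IH -mulrnDr doubleS addn2.
  (* Once around the cycle: the index 3 is 0 in ['Z_3], and s_0 = 0. *)
  have u6 : t *+ 6 = 0.
    by rewrite -(sE 3) -[RHS](bd_zero st); congr s; apply: val_inj.
  have [L LE] := Zp_liftP u6.
  exists L => [i|]; rewrite LE //.
  by rewrite -[in RHS](natr_Zp i) sE; case: i => [[|[|[|]]] ?].
by move=> f _ f1 x; rewrite Zp_additive_nat f1 natr_Zp.
Qed.

(** The shift by e is trivial and no two distinct generators commute by a defining relation, so only
    3 s_1 = 0, 3 s_2 = 0 and 2t = 0 remain; s_1, s_2 and t are the generators of the three
    factors. *)
Lemma homology1_3_0 : (e = 0 %[mod 3])%N ->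
  zmod_isog (homology1 (Z_eps e 3)) ('Z_3 * 'Z_3 * 'Z_2)%type.
Proof.
move=> e0; have eE : e%:R = 0 :> 'Z_3 by rewrite (Zp_natr_mod _ e0).
pose s3 (i : 'Z_3) : ('Z_3 * 'Z_3 * 'Z_2)%type :=
  ((i == 1)%:R, (i == 2%:R)%:R, 0).
apply: (@homology1_initial e 3 ('Z_3 * 'Z_3 * 'Z_2)%type s3 (0, 0, 1)).
- split=> //.
  + by case=> [[|[|[|]]] ?] //; apply/eqP.
  + by case=> [[|[|[|]]] ?] // [[|[|[|]]] ?] //.
  by move=> i; rewrite eE addr0; apply/eqP; case: i => [[|[|[|]]] ?].
- move=> V s t st.
  have t2 : t *+ 2 = 0.
    by apply: (@addrI _ (s 0)); rewrite -(bd_tau st) eE !addr0.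
  have [L1 L1E] := Zp_liftP (braid_data_order3 st 1).
  have [L2 L2E] := Zp_liftP (braid_data_order3 st 2%:R).
  have [L3 L3E] := Zp_liftP t2.
  pose L (x : 'Z_3 * 'Z_3 * 'Z_2) := L1 x.1.1 + L2 x.1.2 + L3 x.2.
  have LM : zmod_morphism L.
    move=> x y; rewrite /L !raddfB /= !opprD.
    by rewrite [in RHS]addrACA [in X in _ = X + _]addrACA.
  pose LA : {additive ('Z_3 * 'Z_3 * 'Z_2)%type -> V} :=
    HB.pack L (GRing.isZmodMorphism.Build _ _ L LM).
  exists LA => [i|]; rewrite /= /L L1E L2E L3E /= ?mulr0n ?add0r ?addr0 //.
  case: i => [[|[|[|]]] lti] //=; rewrite ?mulr0n ?add0r ?addr0.
  + by rewrite -(bd_zero st); congr s; apply: val_inj.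
  + by congr s; apply: val_inj.
  by congr s; apply: val_inj.
move=> f fs ft [[a b] c].
(* The data generate the group, so an additive map fixing them is the identity. *)
have -> : (a, b, c) = s3 1 *+ a + s3 2%:R *+ b + (0, 0, 1) *+ c.
  apply/eqP; move: a b c.
  by case=> [[|[|[|]]] ?] // [[|[|[|]]] ?] // [[|[|]] ?].
by rewrite !raddfD !raddfMn !fs ft.
Qed.

End Cases.

Local Close Scope quotient_scope.
Local Close Scope ring_scope.

Theorem proposition7p4 (e r : nat) (e_ge1 : 1 <= e) (r_ge3 : 3 <= r) :
  [/\ 5 <= r -> zmod_isog (homology1 (Z_eps e r)) 'Z_2,
      r = 4 -> e = 0 %[mod 4] \/ e = 2 %[mod 4] ->
        zmod_isog (homology1 (Z_eps e r)) 'Z_6,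
      r = 4 -> e = 1 %[mod 4] ->
        zmod_isog (homology1 (Z_eps e r)) 'Z_2,
      r = 3 -> e = 0 %[mod 3] ->
        zmod_isog (homology1 (Z_eps e r)) ('Z_3 * 'Z_3 * 'Z_2)%type
    & r = 3 -> e = 1 %[mod 3] ->
        zmod_isog (homology1 (Z_eps e r)) 'Z_6].
Proof.
split; first exact: homology1_ge5.
- by move=> ->; apply: homology1_4_even.
- by move=> ->; apply: homology1_4_1.
- by move=> ->; apply: homology1_3_0.
by move=> ->; apply: homology1_3_1.
Qed.
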